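(* Let $K$ be a perfect field admitting an irreducible polynomial $f(x)\in K[x]$ of degree $n$ whose Galois group over $K$ is the symmetric group $S_n$. Let $k<n$ be a positive integer, and let $L_k$ be the extension of $K$ obtained by adjoining any $k$ of the roots of $f(x)$ (in a fixed algebraic closure $\bar K$). Let $g(x)$ be the minimal polynomial over $K$ of a primitive element of $L_k$. Then $g(x)$ has degree $n!/(n-k)!$ and its root clusters have size $k!$.
   Context: For an irreducible polynomial $h(x)$ over a perfect field $K$ and a root $\gamma$ of $h$ in $\bar K$, the root cluster of $\gamma$ is the set of roots of $h$ lying in the field $K(\gamma)$; its cardinality is the root cluster size of $\gamma$ (it is the same for every root of $h$).
   Formalization: The claim that root clusters have size k! is proved only for k < n−1, since for k = n−1 the field L_k is the whole splitting field and the clusters have size n! (e.g. x²−2 over ℚ with k = 1); the degree formula is proved for all 0 < k < n. *)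

(* Defs.v *)
From HB Require Import structures.
From mathcomp Require Import all_boot all_order all_fingroup all_algebra.
From mathcomp Require Import all_solvable all_field.

Set Implicit Arguments.
Unset Strict Implicit.
Unset Printing Implicit Defensive.

Import GRing.Theory.
Local Open Scope ring_scope.

Definition perfect_field (K : fieldType) : Prop :=
  forall p : {poly K}, irreducible_poly p -> separable_poly p.

(* The Galois group of f is that of a splitting field of f, which is unique up
   to K-isomorphism, so the choice of N is immaterial. *)
Definition galois_group_is_Sym (K : fieldType) (f : {poly K}) (n : nat) : Prop :=
  exists N : splittingFieldType K,
    splittingFieldFor 1%VS (map_poly (in_alg N) f) {:N}%VS /\
    'Gal({:N} / 1)%g \isog [set: 'S_n]%g.

Section AlgebraicClosure.

(* E plays the role of the algebraic closure of K. *)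
Variables (K E : fieldType) (iota : {rmorphism K -> E}).

(* [adjoin S x] means x \in K(S); division includes inverses (and the harmless
   convention z / 0 = 0). *)
Inductive adjoin (S : seq E) : E -> Prop :=
| adjoin_base (a : K) : adjoin S (iota a)
| adjoin_gen (s : E) : s \in S -> adjoin S s
| adjoin_sub (x y : E) : adjoin S x -> adjoin S y -> adjoin S (x - y)
| adjoin_div (x y : E) : adjoin S x -> adjoin S y -> adjoin S (x / y).

Definition primitive_element (S : seq E) (theta : E) : Prop :=
  forall x : E, adjoin [:: theta] x <-> adjoin S x.

Definition minimal_polynomial (theta : E) (g : {poly K}) : Prop :=
  [/\ g \is monic, root (map_poly iota g) theta &
      forall p : {poly K},
        p != 0 -> root (map_poly iota p) theta -> (size g <= size p)%N].

Definition root_cluster (h : {poly K}) (gamma x : E) : Prop :=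
  root (map_poly iota h) x /\ adjoin [:: gamma] x.

(* When K(gamma) / K is normal the cluster of gamma consists of all the roots
   of h, so its size is then the number of roots of h. *)
Definition root_cluster_size (h : {poly K}) (gamma : E) (m : nat) : Prop :=
  exists s : seq E,
    [/\ uniq s, forall x : E, x \in s <-> root_cluster h gamma x & size s = m].

End AlgebraicClosure.

(* Main.v *)
(* Let N be a splitting field of f, with roots r_1, ..., r_n. Every permutation
   of the roots comes from an automorphism of N, so the conjugates of a primitive
   element t of K(r_{u_1}, ..., r_{u_k}) correspond bijectively to the k-tuples w
   of distinct indices, the conjugate v(w) generating K(r_{w_1}, ..., r_{w_k});
   there are n (n - 1) ... (n - k + 1) of them. If n - k >= 2, the only roots of f
   in K(r_{w_1}, ..., r_{w_k}) are the r_{w_i}, so the conjugates of t lying in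
   K(v(w)) are those indexed by the k! rearrangements of w. Everything is carried
   to the algebraic closure by an embedding of N. *)

Require Import Defs.
From HB Require Import structures.
From mathcomp Require Import all_boot all_order all_fingroup all_algebra.
From mathcomp Require Import all_solvable all_field.

Set Implicit Arguments.
Unset Strict Implicit.
Unset Printing Implicit Defensive.

Import GRing.Theory.
Local Open Scope ring_scope.

(** * Embeddings into an algebraically closed field *)

(** By the primitive element theorem [L] is K(z); [phi] sends q(z) to q(b), where b is a root in [E]
    of the minimal polynomial of z. *)
Lemma separable_embedding (K : fieldType) (L : fieldExtType K) (E : closedFieldType)
    (iota : {rmorphism K -> E}) :
  separable 1 {:L} ->
  exists phi : {rmorphism L -> E}, forall a : K, phi a%:A = iota a.
Proof.
move=> sepL.
have genL : {:L}%VS = <<1; separable_generator 1 {:L}>>%VS.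
  exact: (eq_adjoin_separable_generator (K := 1%AS)) sepL (sub1v _).
move: (separable_generator _ _) genL => z genL.
have /polyOver1P[m Dm] := minPolyOver 1%AS z.
have m_neq1 : size (map_poly iota m) != 1%N.
  rewrite size_map_poly -(size_map_poly (in_alg L)) -Dm.
  by rewrite size_minPoly.
have [b mb0] := closed_rootP _ m_neq1.
have exP (x : L) : exists q : {poly K}, x == (map_poly (in_alg L) q).[z].
  by have /Fadjoin1_polyP[q ->] : x \in <<1; z>>%VS; [rewrite -genL memvf | exists q].
pose phi (x : L) := (map_poly iota (xchoose (exP x))).[b].
have phiE (q : {poly K}) : phi (map_poly (in_alg L) q).[z] = (map_poly iota q).[b].
  rewrite /phi; set p := xchoose _.
  have /eqP/esym Dp := xchooseP (exP (map_poly (in_alg L) q).[z]); rewrite -/p in Dp.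
  apply/eqP; rewrite -subr_eq0 -hornerN -hornerD -rmorphB /=.
  (* Two polynomials over K with the same value at z differ by a multiple of [m], so q(b) does not
     depend on the chosen q. *)
  have : m %| p - q.
    rewrite -(dvdp_map (in_alg L)) -Dm minPoly_dvdp ?alg_polyOver //.
    by rewrite rootE rmorphB hornerD hornerN Dp subrr.
  by rewrite -(dvdp_map iota) => /dvdpP[c ->]; rewrite hornerM (rootP mb0) mulr0.
have polyz (x : L) : exists q, x = (map_poly (in_alg L) q).[z].
  by have [q /eqP] := exP x; exists q.
have phi_sub : zmod_morphism phi.
  move=> x y; have [[p ->] [q ->]] := (polyz x, polyz y).
  by rewrite -hornerN -hornerD -rmorphB /= !phiE rmorphB hornerD hornerN.
have phi_mul : monoid_morphism phi.
  split=> [|x y].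
    by have := phiE 1%:P; rewrite !map_polyC !hornerC /= scale1r rmorph1.
  have [[p ->] [q ->]] := (polyz x, polyz y).
  by rewrite -hornerM -rmorphM /= !phiE rmorphM hornerM.
pose phiZ := GRing.isZmodMorphism.Build _ _ phi phi_sub.
pose phiM := GRing.isMonoidMorphism.Build _ _ phi phi_mul.
pose phi' : {rmorphism L -> E} := HB.pack phi phiZ phiM.
by exists phi' => a; have := phiE a%:P; rewrite !map_polyC !hornerC.
Qed.

(** Bridge between the inductive [adjoin] and the subfields of [L]. From right to left the
    generators are adjoined one at a time: the elements of K(T)(s) are polynomials in s over
    K(T). *)
Lemma adjoin_map (K : fieldType) (L : fieldExtType K) (E : fieldType)
    (iota : {rmorphism K -> E}) (phi : {rmorphism L -> E}) :
  (forall a : K, phi a%:A = iota a) ->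
  forall (S : seq L) (x : E),
    adjoin iota (map phi S) x <-> exists2 y, y \in <<1 & S>>%VS & x = phi y.
Proof.
move=> phi_alg S x; split.
  elim=> [a | s /mapP[y Sy ->] | _ _ _ [y Sy ->] _ [z Sz ->]
         | _ _ _ [y Sy ->] _ [z Sz ->]].
  - by exists a%:A; rewrite ?phi_alg // rpredZ // rpred1.
  - by exists y => //; apply: seqv_sub_adjoin.
  - by exists (y - z); rewrite ?rmorphB // rpredB.
  - by exists (y / z); rewrite ?fmorph_div // rpred_div.
case=> y Sy ->{x}; set A := adjoin _ _.
have A0 : A 0 by rewrite -(rmorph0 iota); apply: adjoin_base.
have A1 : A 1 by rewrite -(rmorph1 iota); apply: adjoin_base.
have AN a : A a -> A (- a) by rewrite -[- a]sub0r; apply: adjoin_sub.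
have AD a b : A a -> A b -> A (a + b).
  by move=> Aa /AN; rewrite -{2}[b]opprK; apply: adjoin_sub.
have AM a b : A a -> A b -> A (a * b).
  (* A product is obtained as a / (1 / b), which is also correct for b = 0 since z / 0 = 0. *)
  move=> Aa Ab; rewrite -[b]invrK; apply: adjoin_div => //.
  by rewrite -[b^-1]mul1r; apply: adjoin_div.
(* The induction runs over lists [T] inside [S], so that the target [A] stays fixed. *)
suff sub_adjoin T : {subset T <= S} -> forall z, z \in <<1 & T>>%VS -> A (phi z).
  exact: (sub_adjoin S).
elim/last_ind: T {y Sy} => [_ | T s IH sTS] y.
  rewrite adjoin_nil subfield_closed => /vlineP[a ->].
  by rewrite phi_alg; apply: adjoin_base.
rewrite adjoin_rcons => /Fadjoin_polyP[p /polyOverP Tp ->].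
have As : A (phi s) by apply/adjoin_gen/map_f; apply: sTS; rewrite mem_rcons mem_head.
rewrite -horner_map horner_coef.
apply: (big_ind A) => // i _; apply: (AM).
  rewrite coef_map; apply: IH (Tp i) => a Ta; apply: sTS.
  by rewrite mem_rcons inE Ta orbT.
by elim: (nat_of_ord i) => [|j IHj]; rewrite ?expr0 // exprS; apply: AM.
Qed.

(** * The Galois group as the group of all permutations of the roots *)

(** The symmetric group of [T] is #|T|-transitive, hence k-transitive for smaller k. *)
Lemma Sym_map_uniq (T : finType) (k : nat) (u w : k.-tuple T) :
  uniq u -> uniq w -> exists s : {perm T}, map s u = w.
Proof.
move=> Uu Uw.
have le_k : (k <= #|T|)%N by rewrite -(size_tuple u) -(card_uniqP Uu) max_card.
have /(ntransitive_weak le_k) tr := Sym_trans T.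
have D (x : k.-tuple T) : uniq x -> x \in k.-dtuple(setT).
  by move=> Ux; rewrite inE Ux; apply/subsetP=> y; rewrite inE.
have [s _ Ds] := atransP2 tr (D u Uu) (D w Uw).
by exists s; rewrite Ds; apply: eq_map.
Qed.

(** The equalizer of two endomorphisms is a subfield containing K. *)
Lemma eq_ahom_adjoin_seq (K : fieldType) (L : fieldExtType K) (f g : 'AEnd(L))
    (S : seq L) :
  {in S, f =1 g} -> {in <<1 & S>>%VS, f =1 g}.
Proof.
move=> eqfg; apply/eqlfun_inP; apply/(Fadjoin_seqP (K := 1%AS)).
by split=> [|x Sx]; rewrite ?sub1v //; apply/eqlfunP/eqfg.
Qed.

Lemma gal_of_full (K : fieldType) (N : splittingFieldType K) (x : gal_of {:N}) :
  x \in 'Gal({:N} / 1)%g.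
Proof. by rewrite gal_kAut ?sub1v // kAut1E limg_gal. Qed.

(** The Galois group acts faithfully on the n roots, since they generate [N], and so embeds in S_n.
    The abstract isomorphism gives it order n!, which makes the embedding onto. *)
Lemma Sym_action_on_roots (K : fieldType) (N : splittingFieldType K)
    (f : {poly K}) (n : nat) :
  separable_poly f -> size f = n.+1 ->
  splittingFieldFor 1%VS (map_poly (in_alg N) f) {:N}%VS ->
  'Gal({:N} / 1)%g \isog [set: 'S_n]%g ->
  exists r : 'I_n -> N,
    [/\ injective r,
        map_poly (in_alg N) f %= \prod_i ('X - (r i)%:P),
        forall x : gal_of {:N}, exists s : 'S_n, forall i, x (r i) = r (s i)
      & forall s : 'S_n, exists x : gal_of {:N}, forall i, x (r i) = r (s i)].
Proof.
move=> sepf szf [rs Df genN] isoS.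
have szrs : size rs = n.
  by apply: succn_inj; rewrite -(size_prod_XsubC rs id) -(eqp_size Df) size_map_poly.
have Urs : uniq rs.
  by rewrite -separable_prod_XsubC -(eqp_separable Df) separable_map.
pose r (i : 'I_n) := rs`_i.
have r_inj : injective r.
  by move=> i j /eqP; rewrite nth_uniq ?szrs // => /eqP/val_inj.
have Dprod : \prod_(z <- rs) ('X - z%:P) = \prod_i ('X - (r i)%:P).
  by rewrite (big_nth 0) szrs big_mkord.
have mem_r i : r i \in rs by rewrite mem_nth ?szrs.
have onto_r z : z \in rs -> exists i, z = r i.
  move=> rs_z; have lt_z : (index z rs < n)%N by rewrite -szrs index_mem.
  by exists (Ordinal lt_z); rewrite /r nth_index.
have gal_perm (x : gal_of {:N}) : exists s : 'S_n, forall i, x (r i) = r (s i).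
  have /fin_all_exists[h Dh] i : exists j, x (r i) = r j.
    apply: onto_r; rewrite -root_prod_XsubC -(eqp_root Df).
    have /= <- := fixedPoly_gal (sub1v _) (gal_of_full x) (alg_polyOver 1%AS f).
    by rewrite fmorph_root (eqp_root Df) root_prod_XsubC.
  have h_inj : injective h.
    move=> i j eqh; have : x (r i) = x (r j) by rewrite !Dh eqh.
    by move/fmorph_inj/r_inj.
  by exists (perm h_inj) => i; rewrite permE.
exists r; split=> //; first by rewrite -Dprod.
have [p Dp] := fin_all_exists gal_perm.
have p_inj : injective p.
  move=> x y eqp; apply/eqP/gal_eqP => a _.
  have := memvf a; rewrite -genN; move: a.
  by apply: eq_ahom_adjoin_seq => _ /onto_r[i ->]; rewrite !Dp eqp.
have card_gal : #|{: gal_of {:N}}| = #|{: 'S_n}|.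
  have:= card_isog isoS; rewrite cardsT => <-.
  by apply: eq_card => x; rewrite gal_of_full.
move=> s; have /codomP[x ->] := inj_card_onto p_inj (eq_leq (esym card_gal)) s.
by exists x.
Qed.

(** * Fields generated by k roots, and the conjugates of their generators *)

Section AdjoinedRoots.

Variables (K : fieldType) (N : splittingFieldType K) (n : nat) (r : 'I_n -> N).
Hypothesis r_inj : injective r.
Hypothesis gal_perm :
  forall x : gal_of {:N}, exists s : 'S_n, forall i, x (r i) = r (s i).
Hypothesis perm_gal :
  forall s : 'S_n, exists x : gal_of {:N}, forall i, x (r i) = r (s i).

(* Two points are left outside of [w], and the transposition exchanging them
   fixes K(w) pointwise. *)
Lemma mem_adjoin_roots (w : seq 'I_n) (j : 'I_n) :
  (size w < n.-1)%N -> (r j \in <<1 & map r w>>%VS) = (j \in w).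
Proof.
move=> szw; apply/idP/idP=> [|wj]; last exact/seqv_sub_adjoin/map_f.
apply: contraTT => w'j.
have [j' w'j'] : exists j', j' \notin j :: w.
  apply/existsP; rewrite -negb_forall; apply: contraL szw => /forallP all_w.
  rewrite -leqNgt -subn1 leq_subLR add1n -[X in (X <= _)%N]card_ord.
  apply: leq_trans (card_size (j :: w)).
  by apply/subset_leq_card/subsetP => i _; apply: all_w.
move: w'j'; rewrite inE negb_or => /andP[neq_j w'j'].
have [x Dx] := perm_gal (tperm j j').
apply: contra neq_j => rj; rewrite -(inj_eq r_inj) -{1}[j'](tpermL j j') -Dx.
have <- : \1%VF (r j) = x (r j); last by rewrite id_lfunE.
apply: (eq_ahom_adjoin_seq (f := \1%AF)) rj => _ /mapP[i wi ->].
rewrite Dx id_lfunE tpermD //.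
  by apply: contraNneq w'j => ->.
by apply: contraNneq w'j' => ->.
Qed.

(** Take v(w) to be the image of [t] under an automorphism carrying the roots indexed by [u] to
    those indexed by [w]. Such an automorphism exists by k-transitivity, and its choice does not
    affect v(w). *)
Lemma conjugates_of_primitive_element (k : nat) (u : k.-tuple 'I_n) (t : N) :
  uniq u -> <<1; t>>%VS = <<1 & map r u>>%VS ->
  exists v : k.-tuple 'I_n -> N,
    [/\ {in [pred w : k.-tuple 'I_n | uniq w] &, injective v},
        forall w : k.-tuple 'I_n, uniq w -> <<1; v w>>%VS = <<1 & map r w>>%VS
      & galois 1 {:N} ->
        minPoly 1 t = \prod_(w : k.-tuple 'I_n | uniq w) ('X - (v w)%:P)].
Proof.
move=> Uu gen_t.
have ext (w : k.-tuple 'I_n) :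
    exists x : gal_of {:N}, uniq w -> map x (map r u) = map r w.
  (* Tuples with repetitions get the identity as a dummy value. *)
  have [Uw | _] := boolP (uniq w); last by exists 1%g.
  have [s <-] := Sym_map_uniq Uu Uw; have [x Dx] := perm_gal s.
  by exists x => _; rewrite -!map_comp; apply: eq_map.
have [x Dx] := fin_all_exists ext; pose v w := x w t.
(* As [t] and the roots indexed by [u] generate the same field, two automorphisms agree on [t]
   exactly when they agree on these roots. *)
have eq_on_t (y z : gal_of {:N}) : (y t == z t) = (map y (map r u) == map z (map r u)).
  apply/eqP/eqP=> [eqt | /eq_in_map eqr].
    apply/eq_in_map => a /(seqv_sub_adjoin 1); rewrite -gen_t -adjoin_seq1.
    by apply: eq_ahom_adjoin_seq => _ /[!inE]/eqP->.
  by apply: eq_ahom_adjoin_seq eqr _ _; rewrite -gen_t memv_adjoin.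
have v_inj : {in [pred w : k.-tuple 'I_n | uniq w] &, injective v}.
  move=> w w' Uw Uw' /eqP; rewrite eq_on_t !Dx // => /eqP eqr.
  exact/val_inj/(inj_map r_inj).
exists v; split=> // [w Uw | galN].
  have:= congr1 (fun V => (x w @: V)%VS) gen_t.
  by rewrite /= aimg_adjoin aimg_adjoin_seq aimg1 Dx.
(* Over a Galois extension the minimal polynomial of [t] is the product over its distinct
   conjugates; it remains to match these with the v(w). *)
have [rt /= [_ Urt Drt]] := galois_factors (sub1v _) galN t (memvf t).
have root_rt z : (z \in [seq y t | y : gal_of {:N} <- rt]) = root (minPoly 1 t) z.
  by rewrite Drt root_prod_XsubC.
rewrite Drt -[RHS]big_enum -(big_map v predT (fun z => 'X - z%:P)).
apply/perm_big/uniq_perm=> // [|z].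
  rewrite map_inj_in_uniq ?enum_uniq // => w w'.
  by rewrite !mem_enum; apply: v_inj.
rewrite root_rt; apply/idP/mapP=> [| [w _ ->]]; last first.
  by rewrite (root_minPoly_gal (sub1v _)) ?gal_of_full ?memvf.
(* If y permutes the roots by s, then y(t) is v(s u). *)
rewrite -root_rt => /mapP[y _ ->{z}]; have [s Ds] := gal_perm y.
have Usu : uniq [tuple of map s u] by rewrite map_inj_uniq //; apply: perm_inj.
exists [tuple of map s u]; first by rewrite mem_enum.
apply/eqP; rewrite eq_on_t Dx //=.
by rewrite -!map_comp; apply/eqP/eq_map.
Qed.

End AdjoinedRoots.

(** * Minimal polynomials and root clusters in the algebraic closure *)

Lemma map_poly_in_alg (K : fieldType) (L : fieldExtType K) (E : fieldType)
    (iota : {rmorphism K -> E}) (phi : {rmorphism L -> E}) :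
  (forall a : K, phi a%:A = iota a) ->
  forall p : {poly K}, map_poly iota p = map_poly phi (map_poly (in_alg L) p).
Proof.
move=> phi_alg p; rewrite -map_poly_comp.
by apply: eq_map_poly => a; rewrite /= phi_alg.
Qed.

(** The minimal polynomial of [t] in [L] comes from some [m] over K. It divides [g], and minimality
    bounds the degree of [g] by that of [m]; both are monic. *)
Lemma minimal_polynomial_minPoly (K : fieldType) (L : fieldExtType K) (E : fieldType)
    (iota : {rmorphism K -> E}) (phi : {rmorphism L -> E})
    (phi_alg : forall a : K, phi a%:A = iota a) (t : L) (g : {poly K}) :
  minimal_polynomial iota (phi t) g -> map_poly (in_alg L) g = minPoly 1 t.
Proof.
have phi_map := map_poly_in_alg phi_alg.
case=> g_monic; rewrite phi_map fmorph_root => gt0 g_min.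
have /polyOver1P[m Dm] := minPolyOver 1%AS t.
have m_monic : map_poly (in_alg L) m \is monic by rewrite -Dm monic_minPoly.
have le_gm : (size g <= size m)%N.
  apply: g_min; last by rewrite phi_map fmorph_root -Dm root_minPoly.
  by rewrite -(map_poly_eq0 (in_alg L)) monic_neq0.
have m_dvd_g := minPoly_dvdp (alg_polyOver 1%AS g) gt0.
apply/eqP; rewrite -eqp_monic ?monic_minPoly ?map_monic // eqp_sym.
rewrite -dvdp_size_eqp // eqn_leq dvdp_leq ?monic_neq0 ?map_monic //=.
by rewrite Dm !size_map_poly.
Qed.

(** The cluster size is asserted for k < n - 1. When k = n - 1 the sum of the roots lies in K, so
    the last root is in L_k, which is then the splitting field: every cluster has n! elements
    instead of k!. *)
Theorem theorem3 (K : fieldType) (Kbar : closedFieldType)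
    (iota : {rmorphism K -> Kbar})
    (Kbar_algebraic : forall x : Kbar, algebraicOver iota x)
    (K_perfect : perfect_field K)
    (f : {poly K}) (n : nat)
    (f_irreducible : irreducible_poly f)
    (f_degree : size f = n.+1)
    (f_galois : galois_group_is_Sym f n)
    (k : nat) (k_gt0 : (0 < k)%N) (k_lt_n : (k < n)%N)
    (rs : seq Kbar)
    (rs_uniq : uniq rs)
    (rs_size : size rs = k)
    (rs_roots : {in rs, forall x : Kbar, root (map_poly iota f) x})
    (theta : Kbar) (theta_primitive : primitive_element iota rs theta)
    (g : {poly K}) (g_minimal : minimal_polynomial iota theta g) :
  size g = (n`! %/ (n - k)`!)%N.+1 /\
  ((k < n.-1)%N ->
   forall gamma : Kbar, root (map_poly iota g) gamma ->
     root_cluster_size iota g gamma k`!).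
Proof.
have [N [splitN isoS]] := f_galois.
have sep_f := K_perfect f f_irreducible.
have [r [r_inj Df gal_perm perm_gal]] :=
  Sym_action_on_roots sep_f f_degree splitN isoS.
have galN : galois 1 {:N}.
  apply/splitting_galoisField; exists (map_poly (in_alg N) f).
  by rewrite alg_polyOver separable_map.
have [_ sepN _] := and3P galN.
have [phi phi_alg] := separable_embedding iota sepN.
have phi_map := map_poly_in_alg phi_alg.
(* [phi] carries the roots of f in [N] onto those in [Kbar], so the given list [rs] is indexed by a
   tuple [u]. *)
have [u Drs] : exists u : k.-tuple 'I_n, rs = map phi (map r u).
  have /fin_all_exists[h Dh] (i : 'I_k) : exists j, rs`_i = phi (r j).
    have := rs_roots _ (mem_nth 0 (_ : (i < size rs)%N)).
    rewrite rs_size => /(_ (ltn_ord i)).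
    have /eqp_root Df' := etrans (eqp_map phi _ _) Df; rewrite phi_map Df'.
    rewrite -big_enum -(big_map r predT (fun z => 'X - z%:P)) map_prod_XsubC.
    rewrite -(big_map phi predT (fun z => 'X - z%:P)) root_prod_XsubC.
    by case/mapP=> _ /mapP[j _ ->] ->; exists j.
  exists [tuple h i | i < k].
  rewrite -[LHS](mkseq_nth 0) rs_size /mkseq -val_enum_ord /= -!map_comp.
  exact: eq_map.
have Uu : uniq u by move: rs_uniq; rewrite Drs => /map_uniq/map_uniq.
have adjoinP := adjoin_map phi_alg.
have [t gen_t Dt] : exists2 t, <<1; t>>%VS = <<1 & map r u>>%VS & theta = phi t.
  have [t ru_t Dt] : exists2 t, t \in <<1 & map r u>>%VS & theta = phi t.
    by apply/adjoinP; rewrite -Drs; apply/theta_primitive/adjoin_gen/mem_head.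
  exists t => //; apply/eqP; rewrite -adjoin_seq1 eqEsubv; apply/andP; split.
    by apply/(Fadjoin_seqP (K := 1%AS)); split=> [|_ /[!inE]/eqP->]; rewrite ?sub1v.
  apply/(Fadjoin_seqP (K := 1%AS)); split=> [|z ru_z]; first exact: sub1v.
  have /adjoinP[y t_y /fmorph_inj->//] : adjoin iota (map phi [:: t]) (phi z).
  by rewrite /= -Dt; apply/theta_primitive; rewrite Drs; apply/adjoin_gen/map_f.
have [v [v_inj gen_v /(_ galN) Dmin]] :=
  conjugates_of_primitive_element r_inj gal_perm perm_gal Uu gen_t.
rewrite Dt in g_minimal; have Dg := minimal_polynomial_minPoly phi_alg g_minimal.
split=> [|k_lt gamma].
  (* The degree is the number of k-tuples of distinct indices, the falling factorial of n. *)
  rewrite -(size_map_poly (in_alg N)) Dg Dmin -big_enum size_prod_XsubC -cardE.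
  rewrite -ffact_factd ?(ltnW k_lt_n) //.
  have := card_uniq_tuples k (xpredT : pred 'I_n); rewrite card_ord => <-.
  by congr _.+1; apply: eq_card => w; rewrite !inE all_predT.
have root_g x : root (map_poly iota g) x <->
    exists2 w : k.-tuple 'I_n, uniq w & x = phi (v w).
  rewrite phi_map Dg Dmin -big_enum -(big_map v predT (fun z => 'X - z%:P)).
  rewrite map_prod_XsubC -(big_map phi predT (fun z => 'X - z%:P)) root_prod_XsubC.
  split=> [/mapP[_ /mapP[w w_in ->] ->] | [w Uw ->]]; last by rewrite !map_f // mem_enum.
  by exists w => //; rewrite mem_enum in w_in.
case/root_g=> w Uw ->.
(* v(w') lies in K(v(w)) iff all the roots it generates do; as k < n - 1, these must be among the
   roots indexed by [w]. *)
have v_in w' : uniq (w' : k.-tuple 'I_n) -> (v w' \in <<1; v w>>%VS) = all (mem w) w'.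
  move=> Uw'; rewrite gen_v //.
  have mem_w j : (r j \in <<1 & map r w>>%VS) = (j \in w).
    by apply: mem_adjoin_roots; rewrite ?size_tuple.
  apply/idP/allP=> [vw' j w'j | sw'w].
    rewrite /= -mem_w; have: r j \in <<1; v w'>>%VS.
      by rewrite gen_v //; apply/seqv_sub_adjoin/map_f.
    by apply/subvP/FadjoinP; rewrite sub1v.
  suff: (<<1; v w'>> <= <<1 & map r w>>)%VS by case/FadjoinP.
  rewrite gen_v //; apply/(Fadjoin_seqP (K := 1%AS)); split; first exact: sub1v.
  by move=> _ /mapP[j w'j ->]; rewrite mem_w; apply: sw'w.
pose A := [set w' : k.-tuple 'I_n | all (mem w) w' & uniq w'].
exists [seq phi (v w') | w' in A]; split=> [|x|].
- rewrite map_inj_in_uniq ?enum_uniq // => w1 w2.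
  rewrite !mem_enum !inE => /andP[_ U1] /andP[_ U2] /fmorph_inj.
  exact: v_inj.
- rewrite /root_cluster -[[:: phi _]]/(map phi [:: v w]); split=> [/mapP[w' Aw' ->] | []].
    move: Aw'; rewrite mem_enum inE => /andP[sw' Uw']; split.
      by apply/root_g; exists w'.
    by apply/adjoinP; exists (v w'); rewrite // adjoin_seq1 v_in.
  case/root_g=> w' Uw' -> /adjoinP[y]; rewrite adjoin_seq1 => vy /fmorph_inj Dy.
  by apply/map_f; rewrite mem_enum inE Uw' andbT -v_in // Dy.
(* [A] consists of the injective k-tuples with entries among the k entries of [w], hence of its k!
   rearrangements. *)
- rewrite size_map -cardE card_uniq_tuples -ffactnn; congr (_ ^_ _).
  by rewrite -[RHS](size_tuple w); apply/card_uniqP.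
Qed.
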